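(* Let $G$ be a (finite, simple) graph with $\operatorname{mad}(G) < 3$ and $\Delta(G) \leq 4$. Then $\chi'_{s}(G) \leq 3\Delta(G) + 1$.
   Context: $\Delta(G)$ denotes the maximum degree of $G$. The maximum average degree is $\operatorname{mad}(G) = \max_{H \subseteq G} \frac{2|E(H)|}{|V(H)|}$, the maximum over all (nonempty) subgraphs $H$ of $G$. A strong edge coloring of $G$ is an assignment of colors to the edges such that any two distinct edges $e_1 = uv$ and $e_2$ receive different colors whenever $e_2$ is incident with a vertex of $N_G(u) \cup N_G(v)$ (equivalently, a proper edge coloring in which every color class is an induced matching). The strong chromatic index $\chi'_s(G)$ is the minimum number of colors in a strong edge coloring of $G$. *)

(* Defs.v *)
From mathcomp Require Import all_boot.
Set Implicit Arguments. Unset Strict Implicit. Unset Printing Implicit Defensive.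

Section Graph.
Variables (V : finType) (g : rel V).

Definition simple_graph : Prop := symmetric g /\ irreflexive g.

Definition nbhd (v : V) : {set V} := [set w | g v w].

Definition deg (v : V) : nat := #|nbhd v|.

(* maximum degree Delta(G) (0 for the empty graph) *)
Definition maxdeg : nat := \max_(v : V) deg v.

Definition is_edge (f : {set V}) : bool :=
  [exists u, exists v, (g u v) && (f == [set u; v])].

Definition edges : {set {set V}} := [set f | is_edge f].

Definition edges_in (H : {set V}) : {set {set V}} :=
  [set f in edges | f \subset H].

(* mad(G) < r/ s  i.e.  for every nonempty subgraph H,  2|E(H)|/|V(H)| < r/s.
   It suffices to range over induced subgraphs (they maximize |E| for given
   vertex set). We state mad(G) < 3 as: 2|E(G[H])| < 3|H| for all nonempty H. *)
Definition mad_lt3 : Prop :=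
  forall H : {set V}, H != set0 -> 2 * #|edges_in H| < 3 * #|H|.

Definition conflict (e1 e2 : {set V}) : bool :=
  [&& e1 \in edges, e2 \in edges, e1 != e2 &
   [exists u, exists v, (e1 == [set u; v]) && (g u v) &&
      [exists w, (w \in nbhd u :|: nbhd v) && (w \in e2)]]].

Definition strong_edge_coloring (k : nat) (c : {set V} -> 'I_k) : Prop :=
  forall e1 e2 : {set V}, conflict e1 e2 -> c e1 != c e2.

Definition strong_chi_le (k : nat) : Prop :=
  exists c : {set V} -> 'I_k, strong_edge_coloring c.

End Graph.

(* Main.v *)
Require Import Defs.
From mathcomp Require Import all_boot.
From mathcomp Require Import zify.

(** Induct on a vertex set [H], coloring the edges of [G[H]] with [3 * D + 1]
    colors, [D = maxdeg g]; an edge can be added to a partial coloring when it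
    conflicts with at most [3 * D] colored edges.  Write [d] for degree in
    [G[H]].  By [mad < 3] some vertex has [d <= 2].  If [D <= 3], or if
    [D = 4] and some vertex has [d <= 1], that vertex can be deleted and its
    edges colored greedily.

    For [D = 4], let [v] have degree 2 and neighbors [a], [b], where [d a <= 3]
    or [a] has at least three neighbors of degree 2, and [d b <= 3] or [b] has
    a neighbor of degree 2 other than [v].  Delete [v], erase the colors of all
    edges from [a] to its neighbors of degree 2, color [vb] (at most [2 + 10]
    conflicts), then the edges at [a] (at most [8 + 4] conflicts each).

    If no such [v] exists, let a 4-vertex send charge 1 to its neighbor of
    degree 2 if there is just one, and 1/2 to each if there are two.  Every
    vertex of degree 2 receives at least 1, so the average degree of [G[H]] is
    at least 3, a contradiction. *)

Section StrongColoring.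
Set Implicit Arguments. Unset Strict Implicit. Unset Printing Implicit Defensive.

Variables (V : finType) (g : rel V).
Hypothesis gsym : symmetric g.

Implicit Types (H : {set V}) (S F : {set {set V}}) (u v w x a b : V).

(** * Edges and the conflict relation *)

Definition degin H v := #|nbhd g v :&: H|.

Definition colorable k S := exists c : {set V} -> 'I_k,
  forall e f, e \in S -> f \in S -> conflict g e f -> c e != c f.

Definition conflicts e S := [set f in S | conflict g e f].

Lemma in_edges u v : ([set u; v] \in edges g) = g u v.
Proof.
rewrite inE; apply/existsP/idP => [[x /existsP[y /andP[gxy /eqP E]]]|guv].
  have ux : u \in [set x; y] by rewrite -E set21.
  have vx : v \in [set x; y] by rewrite -E set22.
  have xu : x \in [set u; v] by rewrite E set21.
  have yu : y \in [set u; v] by rewrite E set22.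
  move: ux vx xu yu gxy; rewrite !inE.
  by do 4 ![case/orP => /eqP ?]; subst; rewrite // gsym.
by exists u; apply/existsP; exists v; rewrite guv eqxx.
Qed.

Lemma edgeP e : reflect (exists u v, g u v /\ e = [set u; v]) (e \in edges g).
Proof.
apply: (iffP idP) => [|[u [v [guv ->]]]]; last by rewrite in_edges.
by rewrite inE => /existsP[u /existsP[v /andP[guv /eqP ->]]]; exists u, v.
Qed.

Lemma in_edges_in H u v :
  ([set u; v] \in edges_in g H) = [&& g u v, u \in H & v \in H].
Proof. by rewrite inE in_edges subUset !sub1set. Qed.

Lemma edge_at e u : e \in edges g -> u \in e -> exists2 x, g u x & e = [set u; x].
Proof.
case/edgeP=> x [y [gxy ->]]; rewrite !inE => /orP[] /eqP ->; first by exists y.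
by exists x; rewrite 1?gsym // setUC.
Qed.

(** Adjacency also covers edges sharing a vertex: the other end of [e] is adjacent to the shared
    vertex, which lies in [f]. In this form symmetry is visible. *)
Lemma conflictE e f : conflict g e f = [&& e \in edges g, f \in edges g, e != f &
  [exists u in e, exists w in f, g u w]].
Proof.
rewrite /conflict; case eE: (e \in edges g) => //=; congr [&& _, _ & _].
apply/existsP/exists_inP => [[u /existsP[v /andP[/andP[/eqP eE' guv]]]] /existsP|].
  case=> w /andP[]; rewrite !inE => /orP[guw|gvw] wf.
    by exists u; rewrite ?eE' ?set21 //; apply/exists_inP; exists w.
  by exists v; rewrite ?eE' ?set22 //; apply/exists_inP; exists w.
case=> u ue /exists_inP[w wf guw].
have [v guv ->] := edge_at eE ue.
exists u; apply/existsP; exists v; rewrite eqxx guv /=.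
by apply/existsP; exists w; rewrite !inE guw wf.
Qed.

Lemma conflictC e f : conflict g e f = conflict g f e.
Proof.
rewrite !conflictE andbCA eq_sym; congr [&& _, _, _ & _].
by apply/exists_inP/exists_inP => [] [u ue /exists_inP[w wf guw]];
  exists w => //; apply/exists_inP; exists u; rewrite // gsym.
Qed.

(** * Extending partial colorings *)

Lemma colorableS k S F : F \subset S -> colorable k S -> colorable k F.
Proof.
move=> /subsetP FS [c cP]; exists c => e f eF fF.
by apply: cP; apply: FS.
Qed.

Lemma colorable_add k S e : colorable k S -> #|conflicts e S| < k ->
  colorable k (e |: S).
Proof.
case=> c cP small.
have [i iP] : exists i, i \notin c @: conflicts e S.
  apply/existsP; rewrite -negb_forall; apply/negP => /forallP allc.
  have : #|'I_k| <= #|c @: conflicts e S|.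
    by apply: subset_leq_card; apply/subsetP => i _; apply: allc.
  by rewrite card_ord leqNgt (leq_ltn_trans (leq_imset_card _ _)).
have iN f : f \in S -> conflict g e f -> i != c f.
  move=> fS ef; apply: contraNneq iP => ->.
  by apply: imset_f; rewrite inE fS.
exists (fun f => if f == e then i else c f) => f f'.
rewrite !inE; case: eqP => [->|_] /=; case: eqP => [->|_] //= fS f'S cf.
- by move: cf; rewrite conflictE eqxx !andbF.
- exact: iN.
- by rewrite eq_sym iN // conflictC.
- exact: cP.
Qed.

(** Conflicts are counted in a fixed [T] containing all edges involved, so the edges of [F] can be
    added greedily in any order. *)
Lemma colorable_addU k S F (T : {set {set V}}) :
  S \subset T -> F \subset T -> (forall e, e \in F -> #|conflicts e T| < k) ->
  colorable k S -> colorable k (S :|: F).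
Proof.
move=> ST; have [n] := ubnP #|F|; elim: n F => // n IH F Fn FT small colS.
have [->|[e eF]] := set_0Vmem F; first by rewrite setU0.
rewrite -(setD1K eF) setUCA; apply: colorable_add.
  apply: IH => //; first by move: Fn; rewrite (cardsD1 e) eF.
    by rewrite (subset_trans (subD1set _ _)).
  by move=> f /setD1P[_ /small].
apply: leq_ltn_trans (small e eF); apply: subset_leq_card.
apply/subsetP => f; rewrite !inE => /andP[/orP fST ->]; rewrite andbT.
by case: fST => [/(subsetP ST)|/andP[_ /(subsetP FT)]].
Qed.

(** * Counting conflicts by degrees *)

Definition sdeg S w := #|[set f in S | w \in f]|.

(* An edge [f] in conflict with [uv] meets [N(u) :|: N(v)]; if it does so in
   [v], its other end lies in [N(v)] and differs from [u]. *)
Lemma conflicts_le H S u v : S \subset edges_in g H -> g u v ->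
  #|conflicts [set u; v] S| <=
    \sum_(w in (nbhd g u :&: H) :\ v) sdeg S w +
    \sum_(w in (nbhd g v :&: H) :\ u) sdeg S w.
Proof.
move=> /subsetP SH guv.
have bigcup_le (A : {set V}) :
    #|\bigcup_(w in A) [set f in S | w \in f]| <= \sum_(w in A) sdeg S w.
  rewrite /sdeg; elim/big_rec2: _ => [|w n B _ le]; first by rewrite cards0.
  by rewrite (leq_trans (leq_card_setU _ _)) // leq_add2l.
apply: leq_trans (leq_add (bigcup_le _) (bigcup_le _)).
apply: leq_trans (leq_card_setU _ _); apply/subset_leq_card/subsetP => f.
rewrite [f \in conflicts _ _]inE conflictE => /andP[fS /and4P[_ fE nf]].
case/exists_inP=> y ye /exists_inP[w wf gyw].
have fH x : x \in f -> x \in H.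
  by move: (SH _ fS); rewrite inE => /andP[_ /subsetP]; apply.
have key p q : [set p; q] != f -> g p w -> f \in
   \bigcup_(w in (nbhd g p :&: H) :\ q) [set f in S | w \in f]
   :|: \bigcup_(w in (nbhd g q :&: H) :\ p) [set f in S | w \in f].
  move=> npq gpw; rewrite inE; case: (eqVneq w q) => [wq|wq]; last first.
    apply/orP; left; apply/bigcupP; exists w; last by rewrite inE fS.
    by rewrite !inE wq gpw fH.
  apply/orP; right; subst w; have [x gqx fx] := edge_at fE wf.
  have xf : x \in f by rewrite fx set22.
  apply/bigcupP; exists x; last by rewrite inE fS.
  rewrite !inE gqx fH // !andbT; apply: contraNneq npq => <-.
  by rewrite setUC fx.
move: ye gyw; rewrite !inE -in_setU => /orP[] /eqP -> gyw; first exact: key.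
by rewrite setUC; apply: key; rewrite // setUC.
Qed.

Lemma sdeg_le S w (A : {set V}) : S \subset edges g ->
  (forall x, [set w; x] \in S -> x \in A) -> sdeg S w <= #|A|.
Proof.
move=> /subsetP Sg SA; apply: leq_trans (leq_imset_card (fun x => [set w; x]) _).
apply/subset_leq_card/subsetP => f; rewrite inE => /andP[fS wf].
have [x gwx fx] := edge_at (Sg _ fS) wf.
by rewrite fx; apply/imset_f/SA; rewrite -fx.
Qed.

Lemma edges_in_sub H : edges_in g H \subset edges g.
Proof. by apply/subsetP => e; rewrite inE => /andP[]. Qed.

Lemma sdeg_degin H S w : S \subset edges_in g H -> sdeg S w <= degin H w.
Proof.
move=> SH; apply: sdeg_le => [|x /(subsetP SH)].
  exact: subset_trans SH (edges_in_sub H).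
by rewrite in_edges_in => /and3P[gwx _ xH]; rewrite !inE gwx.
Qed.

Lemma conflicts_degin H u v : g u v ->
  #|conflicts [set u; v] (edges_in g H)| <=
    \sum_(w in (nbhd g u :&: H) :\ v) degin H w +
    \sum_(w in (nbhd g v :&: H) :\ u) degin H w.
Proof.
move=> guv; apply: leq_trans (@conflicts_le H _ _ _ _ guv) _ => //.
by apply: leq_add; apply: leq_sum => w _; apply: sdeg_degin.
Qed.

(** Double counting of incidences; this direction turns [mad_lt3] into an upper bound on the degree
    sum. *)
Lemma handshake H : \sum_(v in H) degin H v <= 2 * #|edges_in g H|.
Proof.
apply: (@leq_trans (\sum_(v in H) \sum_(f in edges_in g H | v \in f) 1)).
  apply: leq_sum => v vH; rewrite sum1_card /degin.
  have inj : injective (fun x => [set v; x]).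
    move=> x y E; have: x \in [set v; y] by rewrite -E set22.
    have: y \in [set v; x] by rewrite E set22.
    by rewrite !inE => /orP[] /eqP -> // /orP[] /eqP ->.
  rewrite -(card_imset _ inj); apply/subset_leq_card/subsetP => f.
  case/imsetP=> x; rewrite !inE => /andP[gvx xH] ->.
  by rewrite unfold_in /= in_edges_in gvx vH xH set21.
rewrite (exchange_big_dep (mem (edges_in g H))) /=; last by move=> v f _ /andP[].
rewrite mulnC -sum_nat_const; apply: leq_sum => f fE.
rewrite sum1_card; have [u [v [_ fuv]]] := edgeP _ (subsetP (edges_in_sub H) _ fE).
apply: leq_trans (_ : #|f| <= 2).
  by apply/subset_leq_card/subsetP => x; rewrite unfold_in /= => /and3P[].
by rewrite fuv cards2; case: (u == v).
Qed.

(** * Reducible configurations *)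

Definition nbhd2 H a := [set x in nbhd g a :&: H | degin H x == 2].

Lemma edges_in_setD1 H v :
  edges_in g (H :\ v) = [set f in edges_in g H | v \notin f].
Proof. by apply/setP => f; rewrite !inE subsetD1 andbA. Qed.

Lemma nbhd_cardD1 H u v : g u v -> v \in H ->
  #|(nbhd g u :&: H) :\ v| = (degin H u).-1.
Proof. by move=> guv vH; rewrite /degin (cardsD1 v (_ :&: _)) !inE guv vH. Qed.

Lemma sum_degin_le H D (A : {set V}) : (forall x, degin H x <= D) ->
  \sum_(w in A) degin H w <= #|A| * D.
Proof. by move=> leD; rewrite -sum_nat_const leq_sum. Qed.

(** With [d] for [degin H], an edge [vx] has at most [(d v - 1 + d x - 1) * D] conflicts, which
    [D + d v <= 5] bounds by [3 * D]. *)
Lemma colorable_low_degree k D H v :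
  (forall x, degin H x <= D) -> D + degin H v <= 5 -> 3 * D < k ->
  colorable k (edges_in g (H :\ v)) -> colorable k (edges_in g H).
Proof.
move=> leD Dv Dk colv; pose F := [set f in edges_in g H | v \in f].
have -> : edges_in g H = edges_in g (H :\ v) :|: F.
  rewrite edges_in_setD1; apply/setP => f; rewrite !in_set -andb_orr.
  by case: (v \in f); rewrite andbT.
apply: (@colorable_addU _ _ _ (edges_in g H)) => //.
- by rewrite edges_in_setD1; apply/subsetP => f; rewrite inE => /andP[].
- by apply/subsetP => f; rewrite inE => /andP[].
move=> f; rewrite inE => /andP[fE vf].
have [x gvx fx] := edge_at (subsetP (edges_in_sub H) _ fE) vf.
move: fE; rewrite fx in_edges_in => /and3P[_ vH xH].
apply: leq_ltn_trans (conflicts_degin H gvx) (leq_ltn_trans _ Dk).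
apply: leq_trans (leq_add (sum_degin_le _ leD) (sum_degin_le _ leD)) _.
rewrite !nbhd_cardD1 // 1?gsym // -mulnDl leq_mul2r.
(* Guards the truncated predecessor: with [degin H v = 0], [D = 5] would be possible. *)
have : 0 < degin H v by apply/card_gt0P; exists x; rewrite !inE gvx.
by have := leD x; have := leD v; lia.
Qed.

(** Each neighbor contributes at most 4, and one of degree 2 leaves 2 to spare. *)
Lemma sum_degin_nbhd2 H a : (forall x, degin H x <= 4) ->
  \sum_(w in nbhd g a :&: H) degin H w + 2 * #|nbhd2 H a| <= 4 * degin H a.
Proof.
move=> le4; rewrite mulnC [X in _ <= X]mulnC -!sum_nat_const.
have -> : \sum_(w in nbhd2 H a) 2 =
    \sum_(w in nbhd g a :&: H) (if degin H w == 2 then 2 else 0).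
  by rewrite -big_mkcondr /=; apply: eq_bigl => w; rewrite inE.
rewrite -big_split /=; apply: leq_sum => w _.
by case: eqP => [->|_] //; rewrite addn0.
Qed.

Lemma sum_degin_nbhd2D1 H a x : (forall x, degin H x <= 4) -> x \in nbhd2 H a ->
  \sum_(w in (nbhd g a :&: H) :\ x) degin H w + 2 * #|nbhd2 H a| + 2
    <= 4 * degin H a.
Proof.
move=> le4; rewrite inE => /andP[xN /eqP x2].
have := sum_degin_nbhd2 a le4; rewrite (big_setD1 x) //= x2.
lia.
Qed.

Lemma colorable_degree2 k H v a b : (forall x, degin H x <= 4) -> v \in H ->
  nbhd g v :&: H = [set a; b] -> a != b ->
  degin H a <= 3 \/ 2 < #|nbhd2 H a| ->
  degin H b <= 3 \/ 1 < #|nbhd2 H b| -> 12 < k ->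
  colorable k (edges_in g (H :\ v)) -> colorable k (edges_in g H).
Proof.
move=> le4 vH Nv ab ha hb k12 colv.
have v2 : degin H v = 2 by rewrite /degin Nv cards2 ab.
have /setIP[] : a \in nbhd g v :&: H by rewrite Nv set21.
rewrite inE => gva aH.
have /setIP[] : b \in nbhd g v :&: H by rewrite Nv set22.
rewrite inE => gvb bH.
have va : v \in nbhd2 H a by rewrite !inE gsym gva vH v2.
have vb : v \in nbhd2 H b by rewrite !inE gsym gvb vH v2.
have ta : 0 < #|nbhd2 H a| by apply/card_gt0P; exists v.
have tb : 0 < #|nbhd2 H b| by apply/card_gt0P; exists v.
(* With [d = degin H a] and [t = #|nbhd2 H a|], the bound [4d - 2t - 2] is at most [12 - 2 - 2] if
   [d <= 3], since [t >= 1], and at most [16 - 6 - 2] if [t >= 3]. *)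
have sum_a x : x \in nbhd2 H a ->
    \sum_(w in (nbhd g a :&: H) :\ x) degin H w <= 8.
  move=> /(sum_degin_nbhd2D1 le4); move: (\sum_(w in _) _) (le4 a) ha ta.
  by clear=> s d4 [? | ?]; lia.
(* Likewise at [b], where [t >= 2] gives [16 - 4 - 2]. *)
have sum_b : \sum_(w in (nbhd g b :&: H) :\ v) degin H w <= 10.
  move: (sum_degin_nbhd2D1 le4 vb); move: (\sum_(w in _) _) (le4 b) hb tb.
  by clear=> s d4 [? | ?]; lia.
have card_a : degin H a - #|nbhd2 H a| <= 2.
  by move: (le4 a) ha ta; clear=> d4 [? | ?]; lia.
pose F := [set [set a; x] | x in nbhd2 H a].
pose S := edges_in g H :\: ([set v; b] |: F).
have SH : S \subset edges_in g H by apply: subsetDl.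
have vbE : [set v; b] \in edges_in g H by rewrite in_edges_in gvb vH.
have FH : F \subset edges_in g H.
  apply/subsetP => _ /imsetP[x xa ->]; rewrite in_edges_in aH.
  by move: xa; rewrite !inE => /andP[/andP[-> ->]].
(* [F] contains [va], so [S] has no edge at [v]. *)
have colS : colorable k S.
  apply: colorableS colv; rewrite edges_in_setD1; apply/subsetP => f.
  rewrite !inE negb_or => /andP[/andP[fvb fF] fE].
  rewrite fE; apply/negP => vf.
  have /edge_at /(_ vf)[x gvx fx] : f \in edges g by case/andP: fE; rewrite inE.
  have : x \in nbhd g v :&: H.
    case/andP: fE => _; rewrite fx subUset !sub1set => /andP[_ xH].
    by rewrite !inE gvx.
  rewrite Nv !inE => /orP[] /eqP xE; subst x; last by rewrite fx eqxx in fvb.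
  by case/negP: fF; rewrite fx setUC; apply: imset_f.
have -> : edges_in g H = ([set v; b] |: S) :|: F.
  apply/setP => f; rewrite /S !in_setU in_setD in_setU in_set1.
  case: (eqVneq f [set v; b]) => [->|_] //=.
  by case fF: (f \in F); rewrite ?orbT ?orbF // (subsetP FH).
apply: (@colorable_addU _ _ _ (edges_in g H)) => //.
- by rewrite subUset sub1set vbE.
- move=> f /imsetP[x xa ->].
  have := xa; rewrite !inE -andbA => /and3P[gax xH /eqP x2].
  apply: leq_ltn_trans (conflicts_degin H gax) (leq_ltn_trans _ k12).
  apply: (leq_add (sum_a x xa) (leq_trans (sum_degin_le _ le4) _)).
  by rewrite nbhd_cardD1 1?gsym // x2.
(* [vb] is colored while [F] is uncolored: only edges of [S] count, and those at [a] lead to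
   neighbors of degree other than 2. *)
apply: colorable_add => //.
apply: leq_ltn_trans (conflicts_le SH gvb) _.
have -> : (nbhd g v :&: H) :\ b = [set a].
  rewrite Nv; apply/setP => x; rewrite !inE; case: (eqVneq x a) => [->|_] /=.
    by rewrite ab.
  by case: (x == b).
rewrite big_set1.
have sa : sdeg S a <= 2.
  apply: leq_trans (_ : #|(nbhd g a :&: H) :\: nbhd2 H a| <= 2).
    apply: sdeg_le; first exact: subset_trans SH (edges_in_sub H).
    move=> x; rewrite !in_setD in_setU negb_or => /andP[/andP[_ xF]].
    rewrite in_edges_in => /and3P[gax _ xH]; rewrite !inE gax xH !andbT /=.
    apply: contraNN xF => x2; apply: imset_f.
    by rewrite !inE gax xH.
  rewrite cardsDS; last by apply/subsetP => x; rewrite inE => /andP[].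
  exact: card_a.
apply: leq_ltn_trans k12; apply: (leq_add sa (leq_trans _ sum_b)).
by apply: leq_sum => w _; apply: sdeg_degin.
Qed.

(** * Discharging *)

(* Twice what [b] sends to each neighbor of degree 2, to stay in integers. *)
Definition charge H b :=
  if degin H b == 4 then
    if #|nbhd2 H b| == 1 then 2 else if #|nbhd2 H b| == 2 then 1 else 0
  else 0.

(** Charge is only moved: both sides sum over the same adjacent pairs. *)
Lemma charge_balance H :
  \sum_(v in H | degin H v == 2) \sum_(b in nbhd g v :&: H) charge H b =
  \sum_(b in H) #|nbhd2 H b| * charge H b.
Proof.
rewrite (exchange_big_dep (mem H)) /=; last by move=> v b _; rewrite inE => /andP[].
apply: eq_bigr => b bH; rewrite -sum_nat_const; apply: eq_bigl => v.
rewrite !inE bH andbT [g b v]gsym; case: (v \in H) => //=; rewrite ?andbF //.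
by rewrite andbC andbT.
Qed.

Lemma discharging H : (forall x, degin H x <= 4) ->
  \sum_(v in H) degin H v < 3 * #|H| ->
  (exists2 v, v \in H & degin H v <= 1) \/
  (exists v a b, [/\ v \in H, nbhd g v :&: H = [set a; b], a != b,
     degin H a <= 3 \/ 2 < #|nbhd2 H a| & degin H b <= 3 \/ 1 < #|nbhd2 H b|]).
Proof.
move=> le4 small.
have [/exists_inP[v]|/exists_inPn noLow] :=
  boolP [exists v in H, degin H v <= 1]; first by left; exists v.
right; pose heavy a := (degin H a <= 3) || (2 < #|nbhd2 H a|).
pose rich b := (degin H b <= 3) || (1 < #|nbhd2 H b|).
have [/exists_inP[v vH /existsP[a /existsP[b]]]|/exists_inPn noRed] :=
  boolP [exists v in H, exists a, exists b,
    [&& nbhd g v :&: H == [set a; b], a != b, heavy a & rich b]].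
  case/and4P=> /eqP Nv ab /orP ha /orP hb.
  by exists v, a, b.
(* Everything is doubled, so 6 stands for average degree 3. The left sum will be read as charge
   sent, the right one as charge received, and vertices compared one by one. *)
suff : \sum_(v in H) 6 + \sum_(b in H) #|nbhd2 H b| * charge H b <=
    \sum_(v in H) 2 * degin H v + \sum_(b in H) #|nbhd2 H b| * charge H b.
  by rewrite leq_add2r -big_distrr sum_nat_const /=; lia.
rewrite -{2}charge_balance big_mkcondr -!big_split /=.
apply: leq_sum => v vH.
have := noLow _ vH; have := le4 v; rewrite -ltnNge => d4 d1.
(* A vertex of degree 3 sends nothing; one of degree 4 sends at most 2 in total, leaving [8 - 2]. *)
case: ifP => [/eqP v2|v2]; last first.
  rewrite /charge; case: eqP => ?; last by lia.
  by do 2 (case: eqP => ?; first by lia); lia.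
rewrite {1}/charge v2 /= muln0.
have /eqP/cards2P[a [b [ab Nv]]] := v2.
have := noRed _ vH; rewrite negb_exists => /forallP noRedv.
(* Used in both orders. A neighbor that is not [rich] sends 2 to [v]. If both are [rich], neither is
   [heavy], so each has exactly two neighbors of degree 2 and sends 1. *)
have red x y : x != y -> nbhd g v :&: H = [set x; y] -> ~~ (heavy x && rich y).
  move=> xy Nxy; have := noRedv x; rewrite negb_exists => /forallP /(_ y).
  by rewrite Nxy eqxx xy.
have {noRedv} := red a b ab Nv; have := red b a; rewrite eq_sym ab setUC.
move=> /(_ isT Nv); rewrite Nv big_setU1 ?inE // big_set1 /=.
have pos x : x \in [set a; b] -> 0 < #|nbhd2 H x|.
  rewrite -Nv !inE => /andP[gvx xH]; apply/card_gt0P; exists v.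
  by rewrite !inE gsym gvx vH v2.
have := pos a; have := pos b; rewrite set21 set22 => /(_ isT) pb /(_ isT) pa.
rewrite /heavy /rich /charge; have := le4 a; have := le4 b.
move: (degin H a) #|nbhd2 H a| (degin H b) #|nbhd2 H b| pa pb.
by clear=> da ta db tb *; do ?(case: eqP => ?); lia.
Qed.

(** * Induction on the vertex set *)

(** Both degree hypotheses pass to induced subgraphs, so [D] and [k] stay fixed while [H]
    shrinks. *)
Lemma colorable_edges_in k D H : (forall v, degin setT v <= D) -> D <= 4 ->
  3 * D < k -> mad_lt3 g -> colorable k (edges_in g H).
Proof.
move=> leDT D4 Dk mad; have [n] := ubnP #|H|; elim: n H => // n IH H Hn.
have [->|Hn0] := eqVneq H set0.
  exists (fun => Ordinal (leq_ltn_trans (leq0n _) Dk)) => e f.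
  rewrite inE => /andP[eE]; have [u [v [_ ->]]] := edgeP _ eE.
  by rewrite subUset sub1set inE.
have leD v : degin H v <= D.
  by apply: leq_trans (leDT v); rewrite subset_leq_card // setIS ?subsetT.
have small := leq_ltn_trans (handshake H) (mad H Hn0).
have colD1 v : v \in H -> colorable k (edges_in g (H :\ v)).
  by move=> vH; apply: IH; move: Hn; rewrite (cardsD1 v) vH.
have [D3|D3] := leqP D 3.
  have [/exists_inP[v vH v2]|/exists_inPn no2] :=
    boolP [exists v in H, degin H v <= 2].
    by apply: (colorable_low_degree leD) (colD1 v vH); lia.
  suff : 3 * #|H| <= \sum_(v in H) degin H v by rewrite leqNgt small.
  rewrite mulnC -sum_nat_const; apply: leq_sum => v vH.
  by rewrite ltnNge no2.
have DE : D = 4 by lia.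
subst D; have [[v vH v1]|[v [a [b [vH Nv ab ha hb]]]]] := discharging leD small.
  by apply: (colorable_low_degree leD) (colD1 v vH); lia.
by apply: (colorable_degree2 leD vH Nv ab ha hb) (colD1 v vH).
Qed.

End StrongColoring.

Theorem theorem2p3 (V : finType) (g : rel V) :
  simple_graph g -> mad_lt3 g -> maxdeg g <= 4 ->
  strong_chi_le g (3 * maxdeg g + 1).
Proof.
case=> gsym _ mad D4.
have leD v : degin g setT v <= maxdeg g.
  by rewrite /degin setIT; apply: (@leq_bigmax _ (deg g)).
have k_gt : 3 * maxdeg g < 3 * maxdeg g + 1 by rewrite addn1.
have [c cP] := colorable_edges_in gsym setT leD D4 k_gt mad.
exists c => e f ef; have := ef; rewrite conflictE // => /and4P[eE fE _ _].
by apply: cP => //; rewrite inE ?eE ?fE subsetT.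
Qed.
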